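(* Let $n\geq 4$ be even, let $P_0\cdots P_{n-1}$ be a regular polygon in $\mathbb{R}^2\subset\mathbb{RP}^2$ (vertices listed in cyclic order), and let $O$ be the intersection point of its great diagonals $P_iP_{i+n/2}$, $0\le i<n/2$. Then the centrally-projective regular polygon $\mathrm{CPol}(O;P_0,\ldots,P_{n-1})$ is $n$-reflective.
   Context: The dynamics takes place in the real projective plane $\mathbb{RP}^2$ (containing $\mathbb{R}^2$ as an affine chart). Projective reflection law: let $p$ be a point and let $T\neq L$ be two lines through $p$ ($T$ is the edge, $L$ the transverse line at $p$). A line $\ell$ through $p$ is reflected into the line $\ell'$ through $p$ if $(\ell,\ell',L,T)$ is harmonic, i.e. has cross-ratio $-1$ (the cross-ratio of four lines through $p$ is the cross-ratio of their intersection points with any fifth line not passing through $p$). Equivalently, $\ell\mapsto \ell'$ is the non-trivial projective involution of the pencil of lines through $p$ fixing $L$ and $T$ (so $L$ and $T$ are reflected into themselves). Polygonal projective billiard: a polygon with vertices $P_0,\dots,P_{n-1}$ (indices modulo $n$), whose edges are the whole lines $\gamma_k=P_kP_{k+1}$, each edge being endowed with a field of transverse lines $M\mapsto L_k(M)\ni M$ for $M\in\gamma_k$. Orbit: for distinct points $M_0\in P_0P_1$, $M_1\in P_1P_2$, the orbit of $(M_0,M_1)$ is the sequence $(M_k)_{k\in\mathbb{Z}}$ with $M_k\in P_kP_{k+1}$ (indices of $P$ modulo $n$) such that for each $k$ the line $M_{k-1}M_k$ is reflected into the line $M_kM_{k+1}$ by the projective reflection law at $M_k$ with edge $\gamma_k$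 and transverse line $L_k(M_k)$. Obstacles between consecutive edges are ignored. For $m$ a positive multiple of $n$, the orbit is $m$-periodic if the lines $M_mM_{m+1}$ and $M_0M_1$ coincide. The billiard is $m$-reflective if there is a non-empty open subset $U\times V\subset P_0P_1\times P_1P_2$ such that the orbit of every $(M_0,M_1)\in U\times V$ is $m$-periodic. Centrally-projective polygon $\mathrm{CPol}(O;P_0,\dots,P_{n-1})$: the polygonal projective billiard on $P_0\cdots P_{n-1}$ in which the transverse line at $M\in\gamma_i=P_iP_{i+1}$ is $L_i(M)=MO$, the line joining $M$ to the point $O$ (the origin), where $O$ does not lie on any edge $\gamma_i$. *)

(* Defs.v *)
From HB Require Import structures.
From mathcomp Require Import all_boot all_order all_algebra.
From mathcomp Require Import all_classical all_reals all_analysis.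

Set Implicit Arguments.
Unset Strict Implicit.
Unset Printing Implicit Defensive.

Import Order.TTheory GRing.Theory Num.Theory numFieldNormedType.Exports.

Local Open Scope classical_set_scope.
Local Open Scope ring_scope.

(* The real projective plane is the lattice of linear subspaces of R^3: points
   have dimension 1, lines have dimension 2, incidence is [<=], the line through
   two distinct points is their sum and the common point of two distinct lines
   is their intersection. *)
Notation psub R := {vspace 'rV[R]_3}.

Section ProjectivePlane.
Context {R : realType}.
Implicit Types (p a b c d : psub R) (l m T L : psub R) (W U : set (psub R)).

Definition is_point p : Prop := \dim p = 1%N.
Definition is_line l : Prop := \dim l = 2%N.

(* [x : y] |-> [x : y : 1] *)
Definition chart (x : 'rV[R]_2) : psub R :=
  <[(row_mx x (const_mx 1 : 'rV[R]_1) : 'rV[R]_3)]>%VS.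

(* Openness for the quotient topology of R^3 \ {0} -> RP^2, v |-> <[v]>; as
   R^3 \ {0} is open in R^3, openness can be tested in R^3. Only the points
   belonging to W matter. *)
Definition popen W : Prop :=
  open [set v : 'rV[R]_3 | v != 0 /\ W <[v]>%VS].

Definition open_on_line l U : Prop :=
  exists2 W, popen W & U = [set p | [/\ is_point p, (p <= l)%VS & W p]].

Definition hdet (s t : R * R) : R := s.1 * t.2 - s.2 * t.1.

(* The cross-ratio (a, b; c, d) of four collinear points is computed in
   homogeneous coordinates relative to a basis (u, v) of the line carrying
   them; in an affine coordinate it is (c - a)(d - b) / ((c - b)(d - a)), so
   that the midpoint of ab and the point at infinity form a harmonic pair with
   respect to the pair (a, b). *)
Definition has_cross_ratio a b c d (r : R) : Prop :=
  exists (u v : 'rV[R]_3) (sa sb sc sd : R * R),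
    let pt (s : R * R) : psub R := <[s.1 *: u + s.2 *: v]>%VS in
    [/\ free [:: u; v],
        [/\ is_point a, is_point b, is_point c & is_point d],
        [/\ a = pt sa, b = pt sb, c = pt sc & d = pt sd],
        hdet sa sd * hdet sb sc != 0 &
        r = (hdet sa sc * hdet sb sd) / (hdet sa sd * hdet sb sc)].

Definition lines_have_cross_ratio p (l1 l2 l3 l4 : psub R) (r : R) : Prop :=
  forall m, is_line m -> ~~ (p <= m)%VS ->
    has_cross_ratio (l1 :&: m)%VS (l2 :&: m)%VS (l3 :&: m)%VS (l4 :&: m)%VS r.

Definition harmonic_lines p (l1 l2 l3 l4 : psub R) : Prop :=
  lines_have_cross_ratio p l1 l2 l3 l4 (-1).

Definition line_through p l : Prop := is_line l /\ (p <= l)%VS.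

(* The cross-ratio is not defined when l is T or L: these two lines are
   reflected into themselves. *)
Definition reflected p T L l l' : Prop :=
  [/\ line_through p T, line_through p L, T <> L,
      line_through p l /\ line_through p l' &
      [\/ harmonic_lines p l l' L T, l = T /\ l' = T | l = L /\ l' = L]].

End ProjectivePlane.

(* Indices modulo n live in 'Z_n, which is Z/nZ as soon as 1 < n; below,
   k%:~R : 'Z_n is the residue class of the integer k. *)
Record polygonal_billiard (R : realType) (n : nat) := PolygonalBilliard {
  vertex : 'Z_n -> psub R;
  transverse : 'Z_n -> psub R -> psub R }.

Section Billiard.
Context {R : realType} {n : nat}.
Implicit Types (B : polygonal_billiard R n) (k : 'Z_n) (p : psub R).

Definition edge B k : psub R := (vertex B k + vertex B (k + 1)%R)%VS.

Definition projective_billiard B : Prop :=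
  forall k, [/\ is_point (vertex B k), is_line (edge B k) &
    forall p, is_point p -> (p <= edge B k)%VS ->
      line_through p (transverse B k p) /\ transverse B k p <> edge B k].

Definition is_orbit B (M0 M1 : psub R) (M : int -> psub R) : Prop :=
  [/\ M 0 = M0, M 1 = M1,
      forall k : int, is_point (M k) /\ (M k <= edge B k%:~R)%VS &
      forall k : int,
        reflected (M k) (edge B k%:~R) (transverse B k%:~R (M k))
          (M (k - 1)%R + M k)%VS (M k + M (k + 1)%R)%VS].

Definition periodic_orbit (m : nat) (M : int -> psub R) : Prop :=
  (M m%:Z + M (m%:Z + 1)%R)%VS = (M 0%R + M 1%R)%VS.

(* "The orbit of (M0, M1) is m-periodic" includes that this orbit exists and is
   unique. *)
Definition reflective (m : nat) B : Prop :=
  [/\ (0 < m)%N, (n %| m)%N &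
   exists U V : set (psub R),
     [/\ open_on_line (edge B 0) U, U !=set0,
         open_on_line (edge B 1) V, V !=set0 &
         forall M0 M1, U M0 -> V M1 ->
           exists M, [/\ is_orbit B M0 M1 M,
             forall M', is_orbit B M0 M1 M' -> M' =1 M &
             periodic_orbit m M]]].

Definition CPol (O : psub R) (P : 'Z_n -> psub R) : polygonal_billiard R n :=
  {| vertex := P; transverse := fun _ p => (p + O)%VS |}.

End Billiard.

Section RegularPolygon.
Context {R : realType}.
Implicit Types u v x y z : 'rV[R]_2.

(* The library norm on row vectors is the sup norm. *)
Definition dotp u v : R := \sum_(i < 2) u 0 i * v 0 i.
Definition enorm u : R := Num.sqrt (dotp u u).

Definition angle_at y x z : R :=
  acos (dotp (x - y) (z - y) / (enorm (x - y) * enorm (z - y))).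

(* Positive iff x, y, z is a counterclockwise triangle. *)
Definition orient x y z : R :=
  (y - x) 0 0 * (z - x) 0 1 - (y - x) 0 1 * (z - x) 0 0.

Context {n : nat}.
Implicit Types (P : 'Z_n -> 'rV[R]_2) (i j : 'Z_n).

(* Strict convexity with the vertices in cyclic order: every edge has all the
   other vertices strictly on the same side, that of the orientation. This
   rules out star polygons. *)
Definition convex_polygon P : Prop :=
  (forall i j, j != i -> j != i + 1 -> 0 < orient (P i) (P (i + 1)) (P j)) \/
  (forall i j, j != i -> j != i + 1 -> orient (P i) (P (i + 1)) (P j) < 0).

Definition equilateral P : Prop :=
  forall i j, enorm (P (i + 1) - P i) = enorm (P (j + 1) - P j).

Definition equiangular P : Prop :=
  forall i j, angle_at (P i) (P (i - 1)) (P (i + 1)) =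
              angle_at (P j) (P (j - 1)) (P (j + 1)).

Definition regular_polygon P : Prop :=
  [/\ convex_polygon P, equilateral P & equiangular P].

End RegularPolygon.

(* Main.v *)
Require Import Defs.
From mathcomp Require Import all_boot all_order all_algebra.
From mathcomp Require Import all_classical all_reals all_analysis.
From mathcomp Require Import ring lra.
Import Order.TTheory GRing.Theory Num.Theory numFieldNormedType.Exports.
Local Open Scope ring_scope.

(* The projective reflection at a point of the edge [f_k = 0] with transverse
   line through the center [O] is induced by the harmonic homology with axis
   that edge and center [O], whatever the point. If [f_k (O) = 1], it maps the
   line [l = 0] to [2 l(O) f_k - l = 0]. For a regular polygon, the line [H_k = 0]
   joining the midpoints of the edges [k] and [k + 1], with [H_k (O) = 1],
   satisfies [H_k + H_{k+1} = 2 f_{k+1}], so the midpoints form an orbit. By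
   linearity the successive lines of any orbit are
   [c H_k + (-1)^k delta = 0] with [delta (O) = 0], and this sequence of lines is
   n-periodic because n is even. *)

Set Implicit Arguments.
Unset Strict Implicit.
Unset Printing Implicit Defensive.

(** * Points and lines of the projective plane *)

Section LinearForms.
Context {R : realType}.
Implicit Types (l h : 'cV[R]_3) (u v w x : 'rV[R]_3) (a b c d p q m L : psub R).

Definition ev l v : R := (v *m l) 0 0.

Lemma evDl l h v : ev (l + h) v = ev l v + ev h v.
Proof. by rewrite /ev mulmxDr mxE. Qed.

Lemma evZl k l v : ev (k *: l) v = k * ev l v.
Proof. by rewrite /ev -scalemxAr mxE. Qed.

Lemma evNl l v : ev (- l) v = - ev l v.
Proof. by rewrite /ev mulmxN mxE. Qed.

Lemma evD l v w : ev l (v + w) = ev l v + ev l w.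
Proof. by rewrite /ev mulmxDl mxE. Qed.

Lemma evZ k l v : ev l (k *: v) = k * ev l v.
Proof. by rewrite /ev -scalemxAl mxE. Qed.

Lemma evN l v : ev l (- v) = - ev l v.
Proof. by rewrite /ev mulNmx mxE. Qed.

Lemma ev0 l : ev l 0 = 0.
Proof. by rewrite /ev mul0mx mxE. Qed.

Definition evE := (evDl, evNl, evZl, evD, evN, evZ, ev0).

Lemma ev_continuous l : continuous (ev l).
Proof.
move=> v; rewrite /ev.
have c j : ((fun x : 'rV[R]_3 => x 0 j * l j 0) @ v --> v 0 j * l j 0)%classic.
  exact: (@continuousM _ _ (fun x : 'rV[R]_3 => x 0 j) (cst (l j 0)) v
    (@coord_continuous R 1 3 0 j v) (@cst_continuous _ _ _ _)).
have -> : (fun x => (x *m l) 0 0) =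
    (fun x => x 0 0 * l 0 0 + x 0 1 * l 1 0 + x 0 (1 + 1) * l (1 + 1) 0).
  apply/funext => x; rewrite mxE !big_ord_recl big_ord0 addr0 addrA.
  by congr (_ + _ + _); congr (x _ _ * l _ _); apply/val_inj.
exact: (cvgD (cvgD (c 0) (c 1)) (c (1 + 1))).
Qed.

Definition kerl l : psub R := lker (linfun (mulmxr l)).

Lemma mem_kerl l v : (v \in kerl l) = (ev l v == 0).
Proof.
rewrite memv_ker lfunE /= /ev; apply/eqP/eqP => [->|e]; first by rewrite mxE.
by apply/matrixP => i j; rewrite !ord1 e [RHS]mxE.
Qed.

(** Rank-nullity: the image of the form has dimension at most 1 and is nonzero because of [v]. *)
Lemma is_line_kerl l v : ev l v != 0 -> is_line (kerl l).
Proof.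
move=> lv; rewrite /is_line /kerl; set g := linfun _.
have := limg_ker_dim g fullv; rewrite capfv dimvf /dim /= => e.
have g1 : (0 < \dim (g @: fullv))%N.
  rewrite lt0n dimv_eq0; apply: contra lv => /eqP g0.
  have : g v \in (g @: fullv)%VS by rewrite memv_img ?memvf.
  by rewrite g0 memv0 lfunE /= /ev => /eqP->; rewrite mxE.
have g2 : (\dim (g @: fullv) <= 1)%N.
  by apply: leq_trans (dimvS (subvf _)) _; rewrite dimvf.
have e1 : (\dim (g @: fullv) = 1)%N by apply/eqP; rewrite eqn_leq g1 g2.
by move: e; rewrite e1 => /eqP; rewrite addn1 eqSS => /eqP.
Qed.

Lemma is_pointP p : is_point p <-> exists2 v, v != 0 & p = <[v]>%VS.
Proof.
split=> [dp|[v v0 ->]]; last by rewrite /is_point dim_vline v0.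
have p0 : p != 0%VS by rewrite -dimv_eq0 dp.
exists (vpick p); first by rewrite vpick0.
apply/esym/eqP; rewrite eqEdim -memvE memv_pick dp dim_vline vpick0.
by rewrite p0.
Qed.

Lemma is_point_vline v : v != 0 -> is_point <[v]>%VS.
Proof. by move=> v0; apply/is_pointP; exists v. Qed.

Lemma eq_line a b : is_line a -> is_line b -> (a <= b)%VS -> a = b.
Proof. by move=> da db ab; apply/eqP; rewrite eqEdim ab da db. Qed.

Lemma eq_point a b : is_point a -> is_point b -> (a <= b)%VS -> a = b.
Proof. by move=> da db ab; apply/eqP; rewrite eqEdim ab da db. Qed.

Lemma line_join p q : is_point p -> is_point q -> ~~ (q <= p)%VS ->
  is_line (p + q)%VS.
Proof.
move=> dp dq qp; rewrite /is_line dimv_disjoint_sum ?dp ?dq //.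
apply/eqP; rewrite -dimv_eq0; apply: contraR qp; rewrite -lt0n => c0.
apply/capv_idPr/eqP; rewrite eqEdim capvSr dq.
by rewrite c0.
Qed.

Lemma line_join_form l v w : ev l v = 0 -> ev l w != 0 -> v != 0 ->
  is_line (<[v]> + <[w]>)%VS.
Proof.
move=> lv lw v0; have w0 : w != 0.
  by apply: contraNneq lw => ->; rewrite ev0.
apply: line_join; [exact: is_point_vline|exact: is_point_vline|].
rewrite -memvE; apply: contra lw => /vlineP[k ->].
by rewrite evZ lv mulr0.
Qed.

Lemma free2_form l v w : ev l v = 0 -> ev l w != 0 -> v != 0 -> free [:: v; w].
Proof.
move=> lv lw v0; rewrite /free span_cons span_seq1.
by rewrite (line_join_form lv lw v0).
Qed.

Lemma lines_meet L m : is_line L -> is_line m ->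
  exists2 v, v != 0 & (v \in L) && (v \in m).
Proof.
move=> dL dm; have := dimv_sum_cap L m; rewrite dL dm => e.
have le3 : (\dim (L + m) <= 3)%N.
  by apply: leq_trans (dimvS (subvf _)) _; rewrite dimvf.
have c0 : (L :&: m)%VS != 0%VS.
  rewrite -dimv_eq0; apply: contraL le3 => /eqP c0.
  by rewrite -ltnNge; move: e; rewrite c0 addn0 => ->.
exists (vpick (L :&: m)); first by rewrite vpick0.
by rewrite -memv_cap memv_pick.
Qed.

Lemma cap_line L m p v : is_line L -> is_point p -> (p <= L)%VS ->
  ~~ (p <= m)%VS -> v != 0 -> v \in L -> v \in m -> (L :&: m)%VS = <[v]>%VS.
Proof.
move=> dL dp pL pm v0 vL vm; apply/esym/eqP; rewrite eqEdim.
rewrite -memvE memv_cap vL vm /= dim_vline v0.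
rewrite leqNgt; apply: contra pm => c2.
have /eqP e : (L :&: m)%VS == L by rewrite eqEdim capvSl dL.
by apply: subv_trans pL _; rewrite -e capvSr.
Qed.

Lemma line_missing p : is_point p -> exists2 m, is_line m & ~~ (p <= m)%VS.
Proof.
case/is_pointP => v v0 ->.
have [i vi] : exists i, v 0 i != 0.
  by apply/existsP; apply: contraR v0; rewrite negb_exists => /forallP h;
     apply/eqP/rowP => i; rewrite mxE; apply/eqP; move: (h i); rewrite negbK.
have e : ev (delta_mx i 0) v = v 0 i.
  by rewrite /ev -colE mxE.
exists (kerl (delta_mx i 0)); first by apply: (@is_line_kerl _ v); rewrite e.
by rewrite -memvE mem_kerl e.
Qed.

End LinearForms.

(** * The reflection law *)

Section Reflection.
Context {R : realType}.
Implicit Types (l h : 'cV[R]_3) (u v w x q o : 'rV[R]_3) (a b c d p m L T : psub R).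

Lemma vline_eq (k k' : R) v w : k != 0 -> k' != 0 -> k *: v = k' *: w ->
  <[v]>%VS = <[w]>%VS.
Proof.
move=> k0 k'0 e; apply/eqP; rewrite eqEsubv -!memvE; apply/andP; split.
  by apply/vlineP; exists (k^-1 * k'); rewrite -scalerA -e scalerK.
by apply/vlineP; exists (k'^-1 * k); rewrite -scalerA e scalerK.
Qed.

Lemma free2P u v :
  free [:: u; v] <-> forall s t : R, s *: u + t *: v = 0 -> s = 0 /\ t = 0.
Proof.
rewrite free_cons span_seq1 seq1_free; split=> [/andP[uv v0] s t e|h].
  have s0 : s = 0.
    apply: contraNeq uv => s0; apply/vlineP; exists (- (s^-1 * t)).
    apply: (scalerI s0); rewrite scalerA mulrN mulVKf // scaleNr.
    by apply/eqP; rewrite -addr_eq0 e.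
  split=> //; move: e; rewrite s0 scale0r add0r => /eqP.
  by rewrite scaler_eq0 (negbTE v0) orbF => /eqP.
apply/andP; split.
  apply/negP => /vlineP[k e]; case: (h 1 (- k)).
    by rewrite scale1r scaleNr e subrr.
  by move/eqP; rewrite oner_eq0.
apply/negP => /eqP e; case: (h 0 1); first by rewrite scale0r e scaler0 addr0.
by move=> _ /eqP; rewrite oner_eq0.
Qed.

(** A coordinate-free form of harmonicity: representatives of the last two points can be scaled so
    that their sum represents the first point, and then their difference represents the second. *)
Lemma harmonicP a b c d : has_cross_ratio a b c d (-1) <->
  exists u v, free [:: u; v] /\
    [/\ c = <[u]>%VS, d = <[v]>%VS, a = <[u + v]>%VS & b = <[u - v]>%VS].
Proof.
split.
  case=> u0 [v0 [sa [sb [sc [sd]]]]] /= [/free2P fr _ [-> -> -> ->] nz r].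
  pose W (s : R * R) : 'rV[R]_3 := s.1 *: u0 + s.2 *: v0.
  have {r} r : hdet sa sc * hdet sb sd = - (hdet sa sd * hdet sb sc).
    by rewrite -[LHS](divfK nz) -r mulN1r.
  move: nz; rewrite mulf_eq0 negb_or => /andP[ad bc].
  have acbd : hdet sa sc * hdet sb sd != 0 by rewrite r oppr_eq0 mulf_neq0.
  have /andP[ac bd] : (hdet sa sc != 0) && (hdet sb sd != 0).
    by rewrite -negb_or -mulf_eq0.
  (* The Plücker relation between the brackets, combined with the cross-ratio [-1]. *)
  have abcd : hdet sa sb * hdet sc sd = 2 * (hdet sa sc * hdet sb sd).
    rewrite mulr_natl mulr2n [X in _ + X]r; rewrite /hdet; ring.
  have cd : hdet sc sd != 0.
    apply: contraNneq acbd => cd0; move: abcd; rewrite cd0 mulr0 => /esym/eqP.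
    by rewrite mulf_eq0 (negbTE (lt0r_neq0 (ltr0Sn R 1))).
  have cramer s : hdet sa sd *: W s = hdet s sd *: W sa + hdet sa s *: W sd.
    apply/rowP => i; rewrite /W /hdet !mxE; ring.
  (* By [cramer] at [sc], these two vectors add up to [hdet sc sd *: W sa]. *)
  exists (hdet sa sd *: W sc), (- hdet sa sc *: W sd); split.
    apply/free2P => s t.
    have -> : s *: (hdet sa sd *: W sc) + t *: (- hdet sa sc *: W sd) =
      (s * hdet sa sd * sc.1 - t * hdet sa sc * sd.1) *: u0 +
      (s * hdet sa sd * sc.2 - t * hdet sa sc * sd.2) *: v0.
      apply/rowP => i; rewrite /W !mxE; ring.
    case/fr => e1 e2.
    have es : s * hdet sa sd * hdet sc sd = 0.
      transitivity ((s * hdet sa sd * sc.1 - t * hdet sa sc * sd.1) * sd.2 -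
        (s * hdet sa sd * sc.2 - t * hdet sa sc * sd.2) * sd.1).
        rewrite /hdet; ring.
      by rewrite e1 e2; ring.
    have et : t * hdet sa sc * hdet sc sd = 0.
      transitivity ((s * hdet sa sd * sc.1 - t * hdet sa sc * sd.1) * sc.2 -
        (s * hdet sa sd * sc.2 - t * hdet sa sc * sd.2) * sc.1).
        rewrite /hdet; ring.
      by rewrite e1 e2; ring.
    split; apply/eqP.
      by move/eqP: es; rewrite !mulf_eq0 (negbTE ad) (negbTE cd) !orbF.
    by move/eqP: et; rewrite !mulf_eq0 (negbTE ac) (negbTE cd) !orbF.
  split.
  - by apply: (vline_eq ad (oner_neq0 _)); rewrite scale1r.
  - apply: (@vline_eq (- hdet sa sc) 1); rewrite ?oppr_eq0 ?oner_neq0 //.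
    by rewrite scale1r.
  - apply: (vline_eq cd (oner_neq0 _)); rewrite scale1r cramer.
    by rewrite scaleNr addrK.
  - apply: (@vline_eq (hdet sc sd * hdet sa sd) (hdet sb sd)) => //.
      by rewrite mulf_neq0.
    rewrite cramer -scalerA cramer.
    have -> : hdet sc sd *: (hdet sb sd *: W sa + hdet sa sb *: W sd) =
      (hdet sc sd * hdet sb sd) *: W sa + (hdet sa sb * hdet sc sd) *: W sd.
      by rewrite scalerDr !scalerA [hdet sa sb * _]mulrC.
    rewrite abcd; apply/rowP => i; rewrite !mxE; ring.
case=> u [v [fr [-> -> -> ->]]].
exists u, v, (1, 1), (1, -1), (1, 0), (0, 1) => /=.
have nz s t : (s != 0) || (t != 0) -> s *: u + t *: v != 0.
  move=> st; apply/eqP; move/free2P: fr => h /h [s0 t0].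
  by move: st; rewrite s0 t0 eqxx.
have e1 : 1 *: u + 1 *: v = u + v by rewrite !scale1r.
have e2 : 1 *: u + (-1) *: v = u - v by rewrite scale1r scaleN1r.
have e3 : 1 *: u + 0 *: v = u by rewrite scale1r scale0r addr0.
have e4 : 0 *: u + 1 *: v = v by rewrite scale1r scale0r add0r.
have n1 : (1 : R) != 0 by rewrite oner_neq0.
rewrite e1 e2 e3 e4; split=> //.
- split; apply: is_point_vline.
  + by rewrite -e1 nz ?n1.
  + by rewrite -e2 nz ?n1.
  + by rewrite -e3 nz ?n1.
  + by rewrite -e4 nz ?n1 ?orbT.
- by rewrite /hdet /= !(mulr0, mul0r, mulr1, mul1r, subr0, sub0r, opprK).
- by rewrite /hdet /=; field.
Qed.

(** Replacing [v] by [- v] in [harmonicP] exchanges the two lines. This lets orbits be followed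
    backwards. *)
Lemma reflected_sym p T L a b : reflected p T L a b -> reflected p T L b a.
Proof.
case=> pT pL TL [pa pb] h; split=> //.
case: h => [h|[-> ->]|[-> ->]]; [|exact: Or32|exact: Or33].
apply: Or31 => m dm pm; apply/harmonicP.
have /harmonicP[u [v [/free2P fr [-> -> -> ->]]]] := h m dm pm.
exists u, (- v); rewrite opprK; split; first last.
  split=> //; apply: (@vline_eq 1 (-1)); rewrite ?oppr_eq0 ?oner_neq0 //.
  by rewrite scale1r scaleN1r opprK.
apply/free2P => s t; rewrite scalerN -scaleNr => /fr[-> /eqP].
by rewrite oppr_eq0 => /eqP.
Qed.

Section Homology.
(* With [h o = l o], the harmonic homology of axis [ker h] and center [o] maps
   the line [ker l] to [ker (2 h - l)]; the point [x] witnesses that [ker l]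
   is not the axis. *)
Variables (l h : 'cV[R]_3) (q o x : 'rV[R]_3).
Hypotheses (q0 : q != 0) (lq : ev l q = 0) (hq : ev h q = 0).
Hypotheses (ho : ev h o != 0) (lo : ev l o = ev h o).
Hypotheses (hx : ev h x = 0) (lx : ev l x != 0).

Let mu : 'cV[R]_3 := 2 *: h - l.
Let g : 'cV[R]_3 := l - h.

Lemma line_axis : is_line (kerl h). Proof. exact: is_line_kerl ho. Qed.

Lemma line_incident : is_line (kerl l).
Proof. by apply: (@is_line_kerl _ _ o); rewrite lo. Qed.

Lemma line_image : is_line (kerl mu).
Proof. by apply: (@is_line_kerl _ _ x); rewrite /mu !evE hx mulr0 add0r oppr_eq0. Qed.

Lemma line_transverse : is_line (<[q]> + <[o]>)%VS.
Proof. exact: line_join_form hq ho q0. Qed.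

(** The forms [l] and [h] agree at [o] and both vanish at [q], so [g] vanishes at both points. *)
Lemma transverse_kerl : (<[q]> + <[o]>)%VS = kerl g.
Proof.
apply: eq_line line_transverse _ _.
  by apply: (@is_line_kerl _ _ x); rewrite /g !evE hx subr0.
by rewrite subv_add -!memvE !mem_kerl /g !evE lq hq lo !subrr eqxx.
Qed.

Lemma qP : is_point <[q]>%VS. Proof. exact: is_point_vline. Qed.

Lemma q_in l' : ev l' q = 0 -> (<[q]> <= kerl l')%VS.
Proof. by move=> e; rewrite -memvE mem_kerl e. Qed.

Lemma muq : ev mu q = 0. Proof. by rewrite /mu !evE hq lq mulr0 subr0. Qed.
Lemma gq : ev g q = 0. Proof. by rewrite /g !evE hq lq subr0. Qed.

Lemma axis_transverse : kerl h <> (<[q]> + <[o]>)%VS.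
Proof.
move=> e; have : o \in kerl h by rewrite e memvE addvSr.
by rewrite mem_kerl (negbTE ho).
Qed.

Lemma reflected_image :
  reflected <[q]> (kerl h) (<[q]> + <[o]>) (kerl l) (kerl mu).
Proof.
split.
- by split; [exact: line_axis|exact: q_in].
- by split; [exact: line_transverse|exact: addvSl].
- exact: axis_transverse.
- by split; split; [exact: line_incident|exact: q_in|exact: line_image
                   |exact: q_in muq].
apply: Or31 => m dm qm; apply/harmonicP; rewrite transverse_kerl.
have dL : is_line (kerl g) by rewrite -transverse_kerl; exact: line_transverse.
have [u u0 /andP[uL um]] := lines_meet dL dm.
have [v v0 /andP[vT vm]] := lines_meet line_axis dm.
have off y : y != 0 -> y \in m -> y \notin <[q]>%VS.
  move=> y0 ym; apply: contra qm => /vlineP[k e]; move: y0.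
  rewrite e scaler_eq0 negb_or => /andP[k0 _].
  by rewrite -memvE -[q](scalerK k0) -e memvZ.
have hu : ev h u != 0.
  apply: contraNneq (off u u0 um) => hu0.
  rewrite -(@cap_line _ (kerl g) (kerl h) <[o]>%VS q) //.
  - by rewrite memv_cap uL mem_kerl hu0 eqxx.
  - by apply: is_point_vline; apply: contraNneq ho => ->; rewrite ev0.
  - by rewrite -transverse_kerl addvSr.
  - by rewrite -memvE mem_kerl.
  - by rewrite mem_kerl gq.
  - by rewrite mem_kerl hq.
have lv : ev l v != 0.
  apply: contraNneq (off v v0 vm) => lv0.
  rewrite -(@cap_line _ (kerl h) (kerl l) <[x]>%VS q) ?mem_kerl ?lq ?hq //.
  - by rewrite memv_cap vT mem_kerl lv0 eqxx.
  - exact: line_axis.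
  - by apply: is_point_vline; apply: contraNneq lx => ->; rewrite ev0.
  - by rewrite -memvE mem_kerl hx.
  - by rewrite -memvE mem_kerl.
have lu : ev l u = ev h u.
  by move: uL; rewrite mem_kerl /g !evE subr_eq0 => /eqP.
have hv : ev h v = 0 by move: vT; rewrite mem_kerl => /eqP.
(* The scaling makes [l] vanish at [u' + v']. As [mu] equals [l] at [u'] and [- l] at [v'], it
   vanishes at [u' - v']. *)
set u' := ev l v *: u; set v' := - ev h u *: v.
have u'0 : u' != 0 by rewrite scaler_eq0 negb_or lv.
have v'0 : v' != 0 by rewrite scaler_eq0 negb_or oppr_eq0 hu.
have fr : free [:: u'; v'].
  apply: (@free2_form _ g) => //; rewrite /g /u' /v' !evE ?lu ?hv; first ring.
  by rewrite mulr0 subr0 mulNr oppr_eq0 mulf_neq0.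
have nz s t : (s != 0) || (t != 0) -> s *: u' + t *: v' != 0.
  move=> st; apply/eqP; move/free2P: fr => f /f [s0 t0].
  by move: st; rewrite s0 t0 eqxx.
have nD : u' + v' != 0.
  by have := nz 1 1; rewrite !scale1r oner_neq0; exact.
have nB : u' - v' != 0.
  by have := nz 1 (-1); rewrite scale1r scaleN1r oner_neq0; exact.
have u'm : u' \in m by rewrite memvZ.
have v'm : v' \in m by rewrite memvZ.
have wD : u' + v' \in m by rewrite rpredD.
have wB : u' - v' \in m by rewrite rpredB.
exists u', v'; split=> //; split; apply: (@cap_line _ _ _ <[q]>%VS) => //;
  rewrite ?mem_kerl //; try exact: q_in.
- exact: qP.
- exact: q_in gq.
- by rewrite /g /u' !evE lu; apply/eqP; ring.
- exact: line_axis.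
- exact: qP.
- by rewrite /v' !evE hv mulr0.
- exact: line_incident.
- exact: qP.
- by rewrite /u' /v' !evE lu; apply/eqP; ring.
- exact: line_image.
- exact: qP.
- exact: q_in muq.
- by rewrite /mu /u' /v' !evE lu hv; apply/eqP; ring.
Qed.

(** The points [o] and [x] exclude the two degenerate cases. In the harmonic case one line [m] off
    [q] suffices: it yields a second point, [u - v], common to [l'] and [kerl mu]. *)
Lemma reflected_unique (l' : psub R) :
  reflected <[q]> (kerl h) (<[q]> + <[o]>) (kerl l) l' -> l' = kerl mu.
Proof.
case=> _ _ _ [_ [dl' ql']] [hm|[e _]|[e _]]; first last.
- have : o \in kerl l by rewrite e memvE addvSr.
  by rewrite mem_kerl lo (negbTE ho).
- have : x \in kerl l by rewrite e mem_kerl hx.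
  by rewrite mem_kerl (negbTE lx).
have [m dm qm] := line_missing qP.
have /harmonicP[u [v [fr [eL eT el el']]]] := hm m dm qm.
move: eL; rewrite transverse_kerl => eL.
have /andP[] : (u \in kerl g) && (u \in m) by rewrite -memv_cap eL memv_line.
rewrite mem_kerl /g !evE subr_eq0 => /eqP lu _.
have /andP[] : (v \in kerl h) && (v \in m) by rewrite -memv_cap eT memv_line.
rewrite mem_kerl => /eqP hv _.
have /andP[] : (u + v \in kerl l) && (u + v \in m).
  by rewrite -memv_cap el memv_line.
rewrite mem_kerl evD => /eqP luv _.
have /andP[wl' wm] : (u - v \in l') && (u - v \in m).
  by rewrite -memv_cap el' memv_line.
have w0 : u - v != 0.
  apply/eqP => w0; move/free2P: fr => /(_ 1 (-1)).
  by rewrite scale1r scaleN1r w0 => /(_ erefl)[/eqP]; rewrite oner_eq0.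
have wq : ~~ (<[u - v]> <= <[q]>)%VS.
  apply: contra qm => /(eq_point (is_point_vline w0) qP) <-.
  by rewrite -memvE.
have dj := line_join qP (is_point_vline w0) wq.
have <- : (<[q]> + <[u - v]>)%VS = l'.
  by apply: eq_line => //; rewrite subv_add ql' -memvE.
apply: eq_line dj line_image _.
rewrite subv_add q_in ?muq //= -memvE mem_kerl /mu !evE hv.
apply/eqP; rewrite -[RHS]luv lu; ring.
Qed.

End Homology.
End Reflection.

(** * Small perturbations and open sets of points on an edge *)

Lemma perturbation_neq0 (R : realType) (I : finType) (x a b : I -> R) :
  (forall i, x i != 0) ->
  exists2 e : R, 0 < e & forall s t, `|s| < e -> `|t| < e ->
    forall i, x i + s * a i + t * b i != 0.
Proof.
move=> x0; pose r i := (`|a i| + `|b i|) / `|x i|.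
have r0 i : 0 <= r i by rewrite divr_ge0 ?addr_ge0.
have S0 : 0 < 1 + \sum_i r i by rewrite ltr_pwDl ?ltr01 ?sumr_ge0.
(* Within this radius the perturbation of [x i] is at most [r i / (1 + \sum_i r i)] times [x i] in
   absolute value; the summand 1 makes this ratio less than 1. *)
exists (1 + \sum_i r i)^-1; first by rewrite invr_gt0.
move=> s t sS tS i.
have xi : 0 < `|x i| by rewrite normr_gt0.
have ri : r i < 1 + \sum_i r i.
  rewrite (bigD1 i) //= addrCA -[ltLHS]addr0 ltrD2l.
  by apply: ltr_pwDl; rewrite ?ltr01 ?sumr_ge0.
have st : `|s * a i + t * b i| <= (1 + \sum_i r i)^-1 * (r i * `|x i|).
  rewrite divfK ?gt_eqF // mulrDr; apply: le_trans (ler_normD _ _) _.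
  by rewrite !normrM; apply: lerD; apply: ler_wpM2r => //; exact: ltW.
have lt : `|s * a i + t * b i| < `|x i|.
  by apply: le_lt_trans st _; rewrite mulrA gtr_pMl // mulrC ltr_pdivrMr ?mul1r.
apply: contraTneq lt => e; rewrite -leNgt -normrN.
suff -> : - x i = s * a i + t * b i by [].
by apply/eqP; rewrite eq_sym -addr_eq0 addrC addrA e.
Qed.

Lemma kerlZ (R : realType) (k : R) (l : 'cV[R]_3) :
  k != 0 -> kerl (k *: l) = kerl l.
Proof.
by move=> k0; apply/vspaceP => v; rewrite !mem_kerl evZl mulf_eq0 (negbTE k0).
Qed.

(* [ev H v / ev f v] does not depend on the vector [v] representing [q]. *)
Definition slope_lt (R : realType) (H f : 'cV[R]_3) (e : R) (q : psub R) :=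
  exists2 v, q = <[v]>%VS & `|ev H v| < e * `|ev f v|.

(** The inequality is invariant under scaling of [v], so on vectors it cuts out the preimage of the
    positive reals under a continuous map; its strictness excludes [v = 0]. *)
Lemma popen_slope_lt (R : realType) (H f : 'cV[R]_3) (e : R) :
  popen (slope_lt H f e).
Proof.
rewrite /popen (_ : [set _ | _]%classic =
  ((fun v => e * `|ev f v| - `|ev H v|) @^-1` [set y | 0 < y])%classic).
  apply: open_comp; last exact: open_gt.
  move=> v _; have cn l : ((fun w => `|ev l w|) @ v --> `|ev l v|)%classic.
    exact: cvg_norm (@ev_continuous R l v).
  have cf := @continuousM R _ (cst e) (fun w => `|ev f w|) v
    (@cst_continuous _ _ _ _) (cn f).
  exact: (cvgB cf (cn H)).
apply/seteqP; split=> v /=; rewrite subr_gt0.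
  case=> v0 [w vw lt]; have /vlineP[k e1] : w \in <[v]>%VS.
    by rewrite vw memv_line.
  have k0 : k != 0.
    have : v \in <[w]>%VS by rewrite -vw memv_line.
    apply: contraTneq => k0; rewrite e1 k0 scale0r; apply/negP => /vlineP[k' ev0].
    by move/eqP: v0; rewrite ev0 scaler0.
  by move: lt; rewrite e1 !evZ !normrM mulrCA ltr_pM2l ?normr_gt0.
move=> lt; split; last by exists v.
by apply: contraTneq lt => ->; rewrite !ev0 !normr0 mulr0 ltxx.
Qed.

(** * Orbits of centrally-projective polygons *)

Section CentrallyProjective.
Context {R : realType} {n : nat}.
Variables (n_gt1 : (1 < n)%N) (n_even : ~~ odd n).
Variables (p : 'Z_n -> 'rV[R]_3) (o : 'rV[R]_3) (f H : 'Z_n -> 'cV[R]_3).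
Hypotheses (f_left : forall k, ev (f k) (p k) = 0).
Hypotheses (f_right : forall k, ev (f k) (p (k + 1)) = 0).
Hypotheses (f_prev : forall k, ev (f (k + 1)) (p k) != 0).
Hypotheses (f_next : forall k, ev (f k) (p (k + 1 + 1)) != 0).
Hypotheses (fo : forall k, ev (f k) o = 1) (Ho : forall k, ev (H k) o = 1).
(* The homology of axis [ker (f (k + 1))] maps [ker (H k)] to [ker (H (k + 1))]. *)
Hypothesis H_image : forall k, H k + H (k + 1) = 2 *: f (k + 1).
Hypothesis Hp : forall k, ev (H k) (p (k + 1)) != 0.

Let B : polygonal_billiard R n := CPol <[o]>%VS (fun i => <[p i]>%VS).

Lemma p_neq0 k : p k != 0.
Proof. by apply: contraNneq (f_prev k) => ->; rewrite ev0. Qed.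

Lemma fo_neq0 k : ev (f k) o != 0. Proof. by rewrite fo oner_neq0. Qed.

Lemma edgeE k : edge B k = kerl (f k).
Proof.
apply: eq_line; last by rewrite subv_add -!memvE !mem_kerl f_left f_right eqxx.
  rewrite /edge /= addvC; apply: (@line_join_form _ (f (k + 1))) => //.
  exact: p_neq0.
exact: is_line_kerl (fo_neq0 k).
Qed.

Lemma CPol_projective : projective_billiard B.
Proof.
move=> k; split; first exact: is_point_vline (p_neq0 k).
  by rewrite edgeE; exact: is_line_kerl (fo_neq0 k).
move=> q /is_pointP[w w0 ->]; rewrite edgeE -memvE mem_kerl => /eqP fw.
split; last exact: nesym (axis_transverse (fo_neq0 k)).
by split; [exact: line_join_form fw (fo_neq0 k) w0|exact: addvSl].
Qed.

Let eps (k : 'Z_n) : R := (-1) ^+ odd k.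

(** Since [n] is even, reduction modulo [n] preserves parity, so the sign also alternates at the
    wrap-around to 0. *)
Lemma epsS k : eps (k + 1) = - eps k.
Proof.
have [n' en] : exists n', n = n'.+2 by case: (n) n_gt1 => [|[|n']] // _; exists n'.
rewrite /eps; subst n => /=.
rewrite odd_mod /=; last by apply/negbTE.
by rewrite oddD modn_small //= addbT; case: (odd k); rewrite /= ?opprK.
Qed.

Lemma eps0 : eps 0 = 1. Proof. by []. Qed.

(** * The orbit with given slopes on the first two edges *)

Section Orbit.
Variables s t : R.

Let c : R := 1 - s - t.
(* [mu 0] below vanishes at the points of slopes [s] on edge 0 and [t] on edge 1. *)
Let delta : 'cV[R]_3 := s *: (H 0 - f 1) + t *: (H 0 - f 0).
Let mu (k : 'Z_n) : 'cV[R]_3 := c *: H k + eps k *: delta.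

(** The alternating sign cancels [delta] in the sum of two consecutive forms, leaving [c] times the
    relation [H_image]. *)
Lemma mu_image k : mu (k + 1) = 2 *: (c *: f (k + 1)) - mu k.
Proof.
rewrite scalerA [2 * c]mulrC -scalerA -H_image /mu epsS.
by apply/matrixP => i j; rewrite !mxE; ring.
Qed.

Lemma mu0 : mu 0 = H 0 - s *: f 1 - t *: f 0.
Proof. by apply/matrixP => i j; rewrite /mu eps0 /c /delta !mxE; ring. Qed.

Lemma muo k : ev (mu k) o = c.
Proof. by rewrite /mu /delta !evE !Ho !fo !subrr !mulr0 addr0 mulr0 addr0 mulr1. Qed.

Hypothesis c_neq0 : c != 0.
Hypothesis mu_next : forall k, ev (mu k) (p (k + 1)) != 0.

(** The combination of two consecutive vertices killed by [mu k]: the point where the line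
    [mu k = 0] crosses edge [k]. *)
Let pt (k : 'Z_n) : 'rV[R]_3 :=
  ev (mu k) (p (k + 1)) *: p k - ev (mu k) (p k) *: p (k + 1).

Lemma f_pt k : ev (f k) (pt k) = 0.
Proof. by rewrite /pt !evE f_left f_right; ring. Qed.

Lemma mu_pt k : ev (mu k) (pt k) = 0.
Proof. by rewrite /pt !evE; ring. Qed.

(** This is why two consecutive lines cut the edge [k + 1] at the same point. *)
Lemma muS v k : ev (f (k + 1)) v = 0 -> ev (mu (k + 1)) v = - ev (mu k) v.
Proof. by move=> fv; rewrite mu_image !evE fv; ring. Qed.

Lemma mu_ptS k : ev (mu k) (pt (k + 1)) = 0.
Proof.
by apply/eqP; rewrite -oppr_eq0 -muS ?f_pt // mu_pt.
Qed.

Lemma mu_vertex k : ev (mu (k + 1)) (p (k + 1)) != 0.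
Proof. by rewrite muS ?f_left // oppr_eq0. Qed.

Lemma f_ptS k : ev (f k) (pt (k + 1)) != 0.
Proof.
rewrite /pt evD evN !evZ f_right mulr0 add0r oppr_eq0 mulf_neq0 //.
exact: mu_vertex.
Qed.

Lemma pt_neq0 k : pt k != 0.
Proof.
rewrite -[k](subrK 1).
by apply: contraNneq (f_ptS (k - 1)) => ->; rewrite ev0.
Qed.

Lemma is_line_mu k : is_line (kerl (mu k)).
Proof. exact: is_line_kerl (mu_next k). Qed.

Lemma is_line_f k : is_line (kerl (f k)).
Proof. exact: is_line_kerl (fo_neq0 k). Qed.

Lemma join_pt k : (<[pt k]> + <[pt (k + 1)%R]>)%VS = kerl (mu k).
Proof.
apply: eq_line (is_line_mu k) _.
  exact: line_join_form (f_pt k) (f_ptS k) (pt_neq0 k).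
by rewrite subv_add -!memvE !mem_kerl mu_pt mu_ptS eqxx.
Qed.

Lemma pt_unique k q : is_point q -> (q <= kerl (f k))%VS ->
  (q <= kerl (mu k))%VS -> q = <[pt k]>%VS.
Proof.
move=> dq qf qmu; apply: eq_point => //.
  by apply: is_point_vline; exact: pt_neq0.
rewrite -(@cap_line _ (kerl (f k)) (kerl (mu k)) <[p (k + 1)%R]>%VS).
- by rewrite subv_cap qf.
- exact: is_line_f.
- by apply: is_point_vline; exact: p_neq0.
- by rewrite -memvE mem_kerl f_right.
- by rewrite -memvE mem_kerl.
- exact: pt_neq0.
- by rewrite mem_kerl f_pt.
- by rewrite mem_kerl mu_pt.
Qed.

Lemma pt_uniqueS k q : is_point q -> (q <= kerl (f (k + 1)%R))%VS ->
  (q <= kerl (mu k))%VS -> q = <[pt (k + 1)%R]>%VS.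
Proof.
move=> dq qf qmu; apply: pt_unique => //.
case/is_pointP: dq qf qmu => v _ ->; rewrite -!memvE !mem_kerl => /eqP fv.
by rewrite muS // oppr_eq0.
Qed.

(** The axis form is rescaled to [c *: f (k + 1)] so as to agree with [mu k] at [o]. The vertex
    [p (k + 1)] lies on the axis but not on the incident line. *)
Lemma reflected_pt k :
  reflected <[pt (k + 1)%R]> (kerl (f (k + 1)%R)) (<[pt (k + 1)%R]> + <[o]>)
    (kerl (mu k)) (kerl (mu (k + 1)%R)).
Proof.
rewrite mu_image -(kerlZ _ c_neq0).
apply: (@reflected_image _ _ _ _ _ (p (k + 1))) => //.
- exact: pt_neq0.
- exact: mu_ptS.
- by rewrite evZl f_pt mulr0.
- by rewrite evZl fo mulr1.
- by rewrite evZl fo mulr1 muo.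
- by rewrite evZl f_left mulr0.
Qed.

Lemma reflected_pt_unique k (l' : psub R) :
  reflected <[pt (k + 1)%R]> (kerl (f (k + 1)%R)) (<[pt (k + 1)%R]> + <[o]>)
    (kerl (mu k)) l' -> l' = kerl (mu (k + 1)%R).
Proof.
rewrite mu_image -(kerlZ (f (k + 1)) c_neq0).
apply: (@reflected_unique _ _ _ _ _ (p (k + 1))) => //.
- exact: pt_neq0.
- exact: mu_ptS.
- by rewrite evZl f_pt mulr0.
- by rewrite evZl fo mulr1.
- by rewrite evZl fo mulr1 muo.
- by rewrite evZl f_left mulr0.
Qed.

(** Both the reflection law and the relation [mu k + mu (k + 1) = 2 *: (c *: f (k + 1))] are
    symmetric in the two lines. *)
Lemma reflected_pt_unique_back k (l' : psub R) :
  reflected <[pt (k + 1)%R]> (kerl (f (k + 1)%R)) (<[pt (k + 1)%R]> + <[o]>)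
    l' (kerl (mu (k + 1)%R)) -> l' = kerl (mu k).
Proof.
move/reflected_sym; rewrite -(kerlZ (f (k + 1)) c_neq0).
have -> : mu k = 2 *: (c *: f (k + 1)) - mu (k + 1).
  by rewrite mu_image opprB addrC subrK.
apply: (@reflected_unique _ _ _ _ _ (p (k + 1))) => //.
- exact: pt_neq0.
- exact: mu_pt.
- by rewrite evZl f_pt mulr0.
- by rewrite evZl fo mulr1.
- by rewrite evZl fo mulr1 muo.
- by rewrite evZl f_left mulr0.
- exact: mu_vertex.
Qed.

Let M (k : int) : psub R := <[pt k%:~R]>%VS.

Lemma intr_succ (k : int) : (k + 1)%:~R = k%:~R + 1 :> 'Z_n.
Proof. exact: intrD. Qed.

Lemma intr_pred (k : int) : k%:~R = (k - 1)%:~R + 1 :> 'Z_n.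
Proof. by rewrite intrB subrK. Qed.

Lemma orbit_pt : is_orbit B <[pt 0]> <[pt 1]> M.
Proof.
split=> //; move=> k.
  split; first by apply: is_point_vline; exact: pt_neq0.
  by rewrite edgeE -memvE mem_kerl f_pt.
rewrite edgeE /M /= intr_succ join_pt intr_pred join_pt.
exact: reflected_pt.
Qed.

(** Two consecutive points force the next and the previous one: the reflected line is determined and
    meets the adjacent edge in one point. Hence the induction in both directions carries pairs of
    consecutive points. *)
Lemma orbit_pt_unique (M' : int -> psub R) :
  is_orbit B <[pt 0]> <[pt 1]> M' -> M' =1 M.
Proof.
case=> M'0 M'1 M'e M'r.
have fwd k : M' (k - 1) = M (k - 1) -> M' k = M k -> M' (k + 1) = M (k + 1).
  move=> e1 e2; have := M'r k; rewrite edgeE /= e1 e2 /M intr_pred join_pt.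
  move/reflected_pt_unique => e.
  have [dq] := M'e (k + 1); rewrite edgeE intr_succ.
  move=> qe; apply: pt_uniqueS => //.
  by rewrite intr_pred -e addvSr.
have bwd k : M' k = M k -> M' (k + 1) = M (k + 1) -> M' (k - 1) = M (k - 1).
  move=> e1 e2; have := M'r k.
  rewrite edgeE /= e1 e2 /M intr_succ join_pt.
  rewrite intr_pred.
  move/reflected_pt_unique_back => e.
  have [dq] := M'e (k - 1); rewrite edgeE.
  move=> qe; apply: pt_unique => //.
  by rewrite -e addvSl.
suff h k : M' k = M k /\ M' (k + 1) = M (k + 1) by move=> k; case: (h k).
elim/int_rect: k => [|k [e1 e2]|k [e1 e2]].
- by rewrite M'0 add0r M'1.
- have -> : k.+1%:Z = k%:Z + 1 by rewrite -addn1 PoszD.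
  by split=> //; apply: fwd => //; rewrite addrK.
- have -> : - k.+1%:Z = - k%:Z - 1 by rewrite -opprD -PoszD addn1.
  by rewrite subrK; split=> //; apply: bwd.
Qed.

Lemma orbit_pt_periodic : periodic_orbit n M.
Proof.
have n0 : (n%:Z)%:~R = 0 :> 'Z_n by rewrite -pmulrn pchar_Zp.
by rewrite /periodic_orbit /M intr_succ n0 add0r.
Qed.

End Orbit.

Lemma CPol_reflective : reflective n B.
Proof.
split=> //; first by rewrite ltnW.
have [e e0 he] : exists2 e : R, 0 < e & forall s t, `|s| < e -> `|t| < e ->
    1 - s - t != 0 /\ forall k, ev ((1 - s - t) *: H k +
      eps k *: (s *: (H 0 - f 1) + t *: (H 0 - f 0))) (p (k + 1)) != 0.
  (* [None] encodes [1 - s - t != 0] and [Some k] the condition at the vertex [k + 1]; [x] is the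
     value at [s = t = 0], while [y (f 1)] and [y (f 0)] are the coefficients of [s] and [t]. *)
  pose x (k : option 'Z_n) := if k is Some k then ev (H k) (p (k + 1)) else 1.
  pose y (h : 'cV[R]_3) (k : option 'Z_n) := if k is Some k then
     eps k * ev (H 0 - h) (p (k + 1)) - ev (H k) (p (k + 1)) else - 1.
  have [|e e0 he] := @perturbation_neq0 R _ x (y (f 1)) (y (f 0)).
    by case=> [k|] //=; rewrite oner_neq0.
  exists e => // s t hs ht; split=> [|k].
    by have := he s t hs ht None; rewrite /= !mulrN1.
  have := he s t hs ht (Some k); rewrite /= !evE; congr (_ != 0); ring.
exists [set q | [/\ is_point q, (q <= edge B 0%R)%VS & slope_lt (H 0) (f 1) e q]]%classic.
exists [set q | [/\ is_point q, (q <= edge B 1%R)%VS & slope_lt (H 0) (f 0) e q]]%classic.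
have f1p0 : ev (f 1) (p 0) != 0 by rewrite -[1]add0r.
have f0p2 : ev (f 0) (p (1 + 1)) != 0 by rewrite -[X in p (X + 1)]add0r.
have Hp1 : ev (H 0) (p 1) != 0 by rewrite -[1]add0r.
have f0p1 : ev (f 0) (p 1) = 0 by rewrite -[1]add0r.
split.
- by exists (slope_lt (H 0) (f 1) e) => //; exact: popen_slope_lt.
(* The point of slope 0, where the line [H 0 = 0] crosses edge 0. *)
- pose v := ev (H 0) (p 1) *: p 0 - ev (H 0) (p 0) *: p 1.
  have fv : ev (f 1) v != 0 by rewrite !evE f_left mulr0 subr0 mulf_neq0.
  exists <[v]>%VS; split.
  + by apply: is_point_vline; apply: contraNneq fv => ->; rewrite ev0.
  + by rewrite edgeE -memvE mem_kerl !evE f_left f0p1 !mulr0 subr0.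
  + exists v => //; rewrite (_ : ev (H 0) v = 0).
      by rewrite normr0 mulr_gt0 ?normr_gt0.
    by rewrite !evE; ring.
- by exists (slope_lt (H 0) (f 0) e) => //; exact: popen_slope_lt.
- pose v := ev (H 0) (p (1 + 1)) *: p 1 - ev (H 0) (p 1) *: p (1 + 1).
  have fv : ev (f 0) v != 0.
    by rewrite !evE f0p1 mulr0 sub0r oppr_eq0 mulf_neq0.
  exists <[v]>%VS; split.
  + by apply: is_point_vline; apply: contraNneq fv => ->; rewrite ev0.
  + by rewrite edgeE -memvE mem_kerl !evE f_left f_right !mulr0 subr0.
  + exists v => //; rewrite (_ : ev (H 0) v = 0).
      by rewrite normr0 mulr_gt0 ?normr_gt0.
    by rewrite !evE; ring.
move=> M0 M1 [d0 e0' [v0 ev0' s0]] [d1 e1' [v1 ev1' s1]].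
rewrite edgeE in e0'; rewrite edgeE in e1'.
have slope (l h : 'cV[R]_3) v : `|ev l v| < e * `|ev h v| ->
    ev h v != 0 /\ `|ev l v / ev h v| < e.
  move=> lt; have h0 : ev h v != 0.
    by apply: contraTneq lt => ->; rewrite normr0 mulr0 ltNge normr_ge0.
  by split=> //; rewrite normrM normfV ltr_pdivrMr ?normr_gt0.
have [h0 {}s0] := slope _ _ _ s0; have [h1 {}s1] := slope _ _ _ s1.
have [c_neq0 mu_next] := he _ _ s0 s1.
have fv0 : ev (f 0) v0 = 0 by move: e0'; rewrite ev0' -memvE mem_kerl => /eqP.
have fv1 : ev (f 1) v1 = 0 by move: e1'; rewrite ev1' -memvE mem_kerl => /eqP.
(* With [s] and [t] the slopes of [M0] and [M1], both points lie on the line [mu 0 = 0], which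
   identifies them with [pt 0] and [pt 1]. *)
have E0 := pt_unique mu_next d0 e0'.
have E1 := @pt_uniqueS _ _ mu_next 0 _ d1.
rewrite add0r in E1.
rewrite {}E0; last first.
  by rewrite ev0' -memvE mem_kerl mu0 !evE fv0 mulr0 subr0 divfK // subrr.
rewrite {}E1 //; last first.
  by rewrite ev1' -memvE mem_kerl mu0 !evE fv1 mulr0 subr0 divfK // subrr.
eexists; split; first exact: orbit_pt c_neq0 mu_next.
- by move=> M'; exact: orbit_pt_unique.
- exact: orbit_pt_periodic.
Qed.

End CentrallyProjective.

(** * Regular polygons *)

Section Plane.
Context {R : realType}.
Implicit Types u v w x G : 'rV[R]_2.

Definition det2 u v : R := u 0 0 * v 0 1 - u 0 1 * v 0 0.

Lemma dotpE u v : dotp u v = u 0 0 * v 0 0 + u 0 1 * v 0 1.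
Proof.
rewrite /dotp !big_ord_recl big_ord0 addr0.
by congr (_ + u _ _ * v _ _); apply/val_inj.
Qed.

Lemma row2P u v : u 0 0 = v 0 0 -> u 0 1 = v 0 1 -> u = v.
Proof.
move=> e0 e1; apply/rowP => -[[|[|//]] h].
  by rewrite (_ : Ordinal h = 0) //; apply/val_inj.
by rewrite (_ : Ordinal h = 1) //; apply/val_inj.
Qed.

Lemma dotp_ge0 u : 0 <= dotp u u.
Proof. by rewrite dotpE -!expr2 addr_ge0 ?sqr_ge0. Qed.

Lemma lagrange u v :
  dotp u v ^+ 2 + det2 u v ^+ 2 = dotp u u * dotp v v.
Proof. by rewrite !dotpE /det2; ring. Qed.

Lemma enormN u : enorm (- u) = enorm u.
Proof. by rewrite /enorm !dotpE !mxE !mulrNN. Qed.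

Lemma orient_det2 x v w : orient x v w = det2 (v - x) (w - x).
Proof. by []. Qed.

(** Up to the factor [dotp w w], these products are the coordinates in the orthogonal basis made of
    [w] and its quarter turn. *)
Lemma vec_by_products w u v : dotp w w != 0 ->
  dotp w u = dotp w v -> det2 w u = det2 w v -> u = v.
Proof.
move=> w0 ep ed.
have key0 (z : 'rV[R]_2) : dotp w w * z 0 0 = w 0 0 * dotp w z - w 0 1 * det2 w z.
  by rewrite !dotpE /det2; ring.
have key1 (z : 'rV[R]_2) : dotp w w * z 0 1 = w 0 1 * dotp w z + w 0 0 * det2 w z.
  by rewrite !dotpE /det2; ring.
by apply: row2P; apply: (mulfI w0); rewrite ?key0 ?key1 ep ed.
Qed.

Definition hvec x : 'rV[R]_3 := row_mx x (const_mx 1 : 'rV[R]_1).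

(* In homogeneous coordinates, the form (x, z) |-> r z + det2 u (x - z G). *)
Definition form_at G (r : R) u : 'cV[R]_3 :=
  col_mx (\col_(i < 2) if i == 0 then - u 0 1 else u 0 0)
    (const_mx (r - det2 u G) : 'cV[R]_1).

Lemma ev_form_at G r u x : ev (form_at G r u) (hvec x) = r + det2 u (x - G).
Proof.
have -> : ev (form_at G r u) (hvec x) =
    (x *m (\col_(i < 2) if i == 0 then - u 0 1 else u 0 0) +
     const_mx 1 *m (const_mx (r - det2 u G) : 'cV[R]_1)) 0 0.
  by rewrite -(@mul_row_col R 1 2 1 1).
rewrite !mxE !big_ord_recl !big_ord0 !mxE /det2 /=.
rewrite !mxE (_ : lift ord0 ord0 = 1); last by apply/val_inj.
by ring.
Qed.

Lemma ev_form_at_center G r u : ev (form_at G r u) (hvec G) = r.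
Proof. by rewrite ev_form_at subrr /det2 !mxE; ring. Qed.

Lemma form_atD G r s u v : form_at G r u + form_at G s v = form_at G (r + s) (u + v).
Proof.
rewrite /form_at [LHS](@add_col_mx R 2 1 1).
apply: (congr2 (@col_mx R 2 1 1)); apply/matrixP => i j; rewrite !mxE.
  by case: ifP => _; rewrite ?opprD.
by rewrite /det2 !mxE; ring.
Qed.

Lemma form_atZ k G r u : k *: form_at G r u = form_at G (k * r) (k *: u).
Proof.
rewrite /form_at [LHS](@scale_col_mx R 2 1 1).
apply: (congr2 (@col_mx R 2 1 1)); apply/matrixP => i j; rewrite !mxE.
  by case: ifP => _; rewrite ?mulrN.
by rewrite /det2 !mxE; ring.
Qed.

End Plane.

Lemma Zn_neq (n i j : nat) : (1 < n)%N -> (i < n)%N -> (j < n)%N -> i != j ->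
  i%:R != j%:R :> 'Z_n.
Proof.
move=> n1 ip jp; apply: contra => /eqP/(congr1 (@nat_of_ord _)).
by rewrite !val_Zp_nat // !modn_small // => ->.
Qed.

Lemma Zn_ind (n : nat) (T : 'Z_n -> Prop) :
  T 0 -> (forall k, T k -> T (k + 1)) -> forall k, T k.
Proof.
move=> T0 TS k; rewrite -[k]natr_Zp.
by elim: (nat_of_ord k) => // m; rewrite -addn1 natrD; exact: TS.
Qed.

(** * From regularity to a recurrence on the edge vectors *)

Section Regular.
Context {R : realType} {n : nat}.
Variables (n_gt3 : (3 < n)%N) (P : 'Z_n -> 'rV[R]_2).
Let e (k : 'Z_n) : 'rV[R]_2 := P (k + 1) - P k.

Lemma convex_turn : convex_polygon P ->
  (forall k, 0 < det2 (e k) (e (k + 1))) \/ (forall k, det2 (e k) (e (k + 1)) < 0).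
Proof.
have E k : orient (P k) (P (k + 1)) (P (k + 1 + 1)) = det2 (e k) (e (k + 1)).
  by rewrite orient_det2 /e /det2 !mxE; ring.
have n1 k : k + 1 + 1 != k :> 'Z_n.
  rewrite -addrA addrC -subr_eq0 addrK (_ : 1 + 1 = 2%:R) //.
  by apply: (@Zn_neq n 2 0) => //; apply: leq_trans n_gt3.
have n2 k : k + 1 + 1 != k + 1 :> 'Z_n.
  rewrite -subr_eq0 addrC addKr.
  by apply: (@Zn_neq n 1 0) => //; apply: leq_trans n_gt3.
by case=> h; [left|right] => k; rewrite -E; apply: h.
Qed.

(** Here [c] is the cosine of the exterior angle, and the recurrence expresses [rho + rho^-1 = 2 c]
    for the rotation [rho] taking each edge vector to the next. *)
Lemma regular_recurrence : regular_polygon P -> exists c d : R,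
  [/\ d != 0, c ^+ 2 < 1, forall k, det2 (e k) (e (k + 1)) = d &
      forall k, e k + e (k + 1 + 1) = (2 * c) *: e (k + 1)].
Proof.
case=> /convex_turn cv el ea.
have det0 k : det2 (e k) (e (k + 1)) != 0.
  by case: cv => h; [rewrite gt_eqF|rewrite lt_eqF].
pose S := dotp (e 0) (e 0).
have eS k : dotp (e k) (e k) = S.
  by apply/eqP; rewrite -eqr_sqrt ?dotp_ge0 //; apply/eqP; exact: (el k 0).
have S0 : 0 < S.
  rewrite lt_def dotp_ge0 andbT; apply: contra (det0 0) => /eqP s0.
  have := lagrange (e 0) (e (0 + 1)); rewrite -/S s0 mul0r => /eqP.
  by rewrite paddr_eq0 ?sqr_ge0 // !sqrf_eq0 => /andP[].
have nS k : enorm (e k) = Num.sqrt S by rewrite /enorm eS.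
pose t k := dotp (e k) (e (k + 1)).
have le k : t k ^+ 2 <= S ^+ 2.
  by have := lagrange (e k) (e (k + 1)); rewrite !eS -expr2 => <-; rewrite lerDl sqr_ge0.
have angle k : angle_at (P (k + 1)) (P (k + 1 - 1)) (P (k + 1 + 1)) = acos (- t k / S).
  rewrite /angle_at addrK -[P k - _]opprB enormN !nS -expr2 sqr_sqrtr ?ltW //.
  congr (acos (_ / _)); rewrite /t !dotpE !mxE; ring.
have itv k : - t k / S \in `[(-1), 1].
  have : `|t k| <= S.
    have S0' := ltW S0.
    by rewrite -(@ler_pXn2r _ 2) ?nnegrE // real_normK ?num_real.
  rewrite ler_norml => /andP[t1 t2].
  by rewrite in_itv /= ler_pdivlMr // ler_pdivrMr // mulN1r mul1r lerN2 t2 lerNl.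
pose T := t 0.
have eT k : t k = T.
  have := ea (k + 1) (0 + 1); rewrite !angle => /(congr1 cos).
  rewrite !acosK // => /(congr1 (fun x => - (x * S))).
  by rewrite !divfK ?gt_eqF // !opprK.
pose d := det2 (e 0) (e (0 + 1)).
(* Lagrange's identity fixes the determinant up to sign; convexity fixes the sign. *)
have ed k : det2 (e k) (e (k + 1)) = d.
  have sq : det2 (e k) (e (k + 1)) ^+ 2 = d ^+ 2.
    have := lagrange (e k) (e (k + 1)); rewrite -[RHS](_ : T ^+ 2 + d ^+ 2 = _).
      by rewrite -/(t k) eT => /addrI.
    by rewrite -(eT 0) lagrange !eS.
  move/eqP: sq; rewrite eqf_sqr => /orP[/eqP //|/eqP ek].
  case: cv => h; have := h k; have := h 0; rewrite -/d ek; lra.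
have d0 : d != 0 by exact: det0.
exists (T / S), d; split=> // [|k].
  rewrite expr_div_n ltr_pdivrMr ?exprn_gt0 // mul1r.
  have := lagrange (e 0) (e (0 + 1)); rewrite !eS -expr2 => <-.
  rewrite -/(t 0) -/d eT ltrDl; have := sqr_ge0 d.
  by rewrite le_eqVlt eq_sym sqrf_eq0 (negbTE d0).
have wS : dotp (e (k + 1)) (e (k + 1)) != 0 by rewrite eS gt_eqF.
(* Against the middle edge, its two neighbours have equal scalar products and opposite
   determinants. *)
apply: (vec_by_products wS).
  have -> : dotp (e (k + 1)) (e k + e (k + 1 + 1)) = t k + t (k + 1).
    by rewrite /t !dotpE !mxE; ring.
  have -> : dotp (e (k + 1)) ((2 * (T / S)) *: e (k + 1)) =
      (2 * (T / S)) * dotp (e (k + 1)) (e (k + 1)).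
    by rewrite !dotpE !mxE; ring.
  by rewrite eS !eT -mulrA divfK ?gt_eqF //; ring.
have -> : det2 (e (k + 1)) (e k + e (k + 1 + 1)) =
    det2 (e (k + 1)) (e (k + 1 + 1)) - det2 (e k) (e (k + 1)).
  by rewrite /det2 !mxE; ring.
by rewrite !ed /det2 !mxE; ring.
Qed.

End Regular.

(** * The center of the polygon and its great diagonals *)

Section Center.
Context {R : realType} {n : nat}.
Variables (P : 'Z_n -> 'rV[R]_2) (c d : R).
Let e (k : 'Z_n) : 'rV[R]_2 := P (k + 1) - P k.
Hypotheses (c_lt1 : c ^+ 2 < 1) (d_neq0 : d != 0).
Hypotheses (det_e : forall k, det2 (e k) (e (k + 1)) = d).
Hypotheses (e_rec : forall k, e k + e (k + 1 + 1) = (2 * c) *: e (k + 1)).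

(* [G] is the center of the polygon: if [rho] is the rotation with
   [e (k + 1) = rho (e k)], of cosine [c], then [P k - G = (rho - 1)^-1 (e k)]. *)
Let a : R := (2 - 2 * c)^-1.
Let D : R := d / (2 - 2 * c).
Let G : 'rV[R]_2 := P 0 - a *: (e (0 - 1) - e 0).
Let Q (k : 'Z_n) : 'rV[R]_2 := P k - G.

Lemma c_itv : (-1 < c) && (c < 1).
Proof.
rewrite -ltr_norml -(@ltr_pXn2r _ 2) ?nnegrE //.
by rewrite expr1n real_normK ?num_real.
Qed.

Lemma c1_neq0 : 2 - 2 * c != 0.
Proof. by have /andP[_ c1] := c_itv; apply: lt0r_neq0; lra. Qed.

Lemma D_neq0 : D != 0.
Proof. by rewrite mulf_neq0 ?invr_eq0 ?c1_neq0. Qed.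

Lemma Q_step k : Q (k + 1) = Q k + e k.
Proof. by rewrite /Q /e [RHS]addrC addrA subrK. Qed.

(** The product of [rho - 1] and [rho^-1 - 1] is [2 - 2 c], so [a] times [rho^-1 - 1] inverts
    [rho - 1]. *)
Lemma QE k : Q k = a *: (e (k - 1) - e k).
Proof.
elim/Zn_ind: k => [|k IH]; first by rewrite /Q /G opprB addrC subrK.
rewrite Q_step.
have := e_rec (k - 1); rewrite subrK => /(canRL (addrK _)) e1.
rewrite IH e1 addrK; apply/rowP => i; rewrite !mxE /a; field.
exact: c1_neq0.
Qed.

Lemma Q_rec k : Q (k + 1 + 1) = (2 * c) *: Q (k + 1) - Q k.
Proof.
have e1 := e_rec (k - 1); rewrite subrK in e1.
have e2 := e_rec k.
have -> : Q (k + 1 + 1) = a *: (e (k + 1) - e (k + 1 + 1)) by rewrite QE addrK.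
have -> : Q (k + 1) = a *: (e k - e (k + 1)) by rewrite QE addrK.
rewrite QE (canRL (addKr _) e2) (canRL (addrK _) e1).
by apply/rowP => i; rewrite !mxE; ring.
Qed.

Lemma det_eQ k : det2 (e k) (Q k) = - D.
Proof.
have := det_e (k - 1); rewrite subrK => dk; rewrite /D -dk QE /a /det2 !mxE.
by field; exact: c1_neq0.
Qed.

Lemma det_eQS k : det2 (e k) (Q (k + 1)) = - D.
Proof. by rewrite -(det_eQ k) Q_step /det2 !mxE; ring. Qed.

(** Thus [D] is twice the signed area of the triangle spanned by [G] and edge [k]. *)
Lemma det_QQ k : det2 (Q k) (Q (k + 1)) = D.
Proof. by rewrite -[D]opprK -(det_eQ k) Q_step /det2 !mxE; ring. Qed.

(** Cayley-Hamilton for the rotation; the coefficients do not depend on [k]. *)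
Lemma Q_comb (m : nat) : exists al be : R,
  forall k, Q (k + m%:R) = al *: Q (k + 1) + be *: Q k.
Proof.
elim: m => [|m [al [be IH]]].
  by exists 0, 1 => k; rewrite addr0 scale0r scale1r add0r.
exists (2 * c * al + be), (- al) => k.
rewrite -[m.+1]addn1 natrD [m%:R + _]addrC addrA IH Q_rec.
by apply/rowP => i; rewrite !mxE; ring.
Qed.

(* If [A] is the rotation about [G] by the angle of the polygon, then
   [A ^ m = al A + be] has square 1, which forces [al = 0] and [be = 1] or [-1]. *)
Lemma half_turn (m : nat) : (m + m)%:R = 0 :> 'Z_n -> P m%:R <> P 0 ->
  forall k, Q (k + m%:R) = - Q k.
Proof.
move=> mm Pm; have [al [be h]] := Q_comb m.
(* Shifting twice by [m] is the identity. Comparing coordinates on [Q (0 + 1)] and [Q 0] gives [E1]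
   and [E2]. *)
have E : Q 0 = (2 * c * al ^+ 2 + 2 * al * be) *: Q (0 + 1) +
    (be ^+ 2 - al ^+ 2) *: Q 0.
  transitivity (Q (0 + m%:R + m%:R)); first by rewrite -addrA -natrD mm addr0.
  rewrite h addrAC !h Q_rec.
  by apply/rowP => i; rewrite !mxE; ring.
have /(congr1 (det2 (Q 0))) := E.
have -> : det2 (Q 0) (Q 0) = 0 by rewrite /det2; ring.
have -> (s t : R) : det2 (Q 0) (s *: Q (0 + 1) + t *: Q 0) =
    s * det2 (Q 0) (Q (0 + 1)) by rewrite /det2 !mxE; ring.
rewrite det_QQ => /esym/eqP; rewrite mulf_eq0 (negbTE D_neq0) orbF => /eqP E1.
have /(congr1 (fun v => det2 v (Q (0 + 1)))) := E.
have -> (s t : R) : det2 (s *: Q (0 + 1) + t *: Q 0) (Q (0 + 1)) =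
    t * det2 (Q 0) (Q (0 + 1)) by rewrite /det2 !mxE; ring.
rewrite det_QQ -[LHS]mul1r => /(mulIf D_neq0) E2.
(* Otherwise [be = - (c * al)], and [E2] equates 1 with the negative number
   [(c ^+ 2 - 1) * al ^+ 2]. *)
have al0 : al = 0.
  apply/eqP; apply: contraTT c_lt1 => al0; rewrite -leNgt.
  have be_ : be = - (c * al).
    apply: (mulfI al0); move: E1; rewrite !expr2; nra.
  have : (c ^+ 2 - 1) * al ^+ 2 = 1 by rewrite [RHS]E2 be_; ring.
  have : 0 < al ^+ 2 by rewrite exprn_even_gt0.
  nra.
have : be ^+ 2 = 1 by rewrite [RHS]E2 al0; ring.
move/eqP; rewrite sqrf_eq1 => /orP[/eqP be1|/eqP be1] k; last first.
  by rewrite h al0 be1 scale0r add0r scaleN1r.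
case: Pm; have := h 0; rewrite al0 be1 scale0r add0r add0r scale1r.
exact: addIr.
Qed.

Let f (k : 'Z_n) := form_at G 1 (D^-1 *: e k).
(** The line joining the midpoints of edges [k] and [k + 1] has direction [e k + e (k + 1)]; the
    scalar makes the form vanish at these midpoints. *)
Let H (k : 'Z_n) := form_at G 1 ((D * (1 + c))^-1 *: (e k + e (k + 1))).

Lemma c2_neq0 : 1 + c != 0.
Proof. by have /andP[c1 _] := c_itv; apply: lt0r_neq0; lra. Qed.

Lemma CPol_center : (1 < n)%N -> ~~ odd n ->
  let B := CPol <[hvec G]>%VS (fun i => chart (P i)) in
  projective_billiard B /\ reflective n B.
Proof.
move=> n_gt1 n_even B.
have detZ k u v : det2 (k *: u) v = k * det2 u v :> R.
  by rewrite /det2 !mxE; ring.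
have detDl u v w : det2 (u + v) w = det2 u w + det2 v w :> R.
  by rewrite /det2 !mxE; ring.
have fl k : ev (f k) (hvec (P k)) = 0.
  by rewrite ev_form_at detZ det_eQ mulrN mulVf ?D_neq0 // subrr.
have fr k : ev (f k) (hvec (P (k + 1))) = 0.
  by rewrite ev_form_at detZ det_eQS mulrN mulVf ?D_neq0 // subrr.
have dD : D^-1 * d != 0 by rewrite mulf_neq0 ?invr_eq0 ?D_neq0.
have fp k : ev (f (k + 1)) (hvec (P k)) != 0.
  rewrite ev_form_at detZ.
  have -> : det2 (e (k + 1)) (P k - G) =
      det2 (e (k + 1)) (Q (k + 1)) + det2 (e k) (e (k + 1)).
    by rewrite /e /Q /det2 !mxE; ring.
  by rewrite det_eQ det_e mulrDr mulrN mulVf ?D_neq0 // addrA subrr add0r.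
have fn k : ev (f k) (hvec (P (k + 1 + 1))) != 0.
  rewrite ev_form_at detZ.
  have -> : det2 (e k) (P (k + 1 + 1) - G) =
      det2 (e k) (Q (k + 1)) + det2 (e k) (e (k + 1)).
    by rewrite /e /Q /det2 !mxE; ring.
  by rewrite det_eQS det_e mulrDr mulrN mulVf ?D_neq0 // addrA subrr add0r.
have fo u := ev_form_at_center G 1 u.
(* By the recurrence the directions add up to [(2 * (1 + c)) *: e (k + 1)], whose factor [1 + c]
   cancels the one in the normalization of [H]. *)
have HI k : H k + H (k + 1) = 2 *: f (k + 1).
  rewrite /H /f form_atD form_atZ mulr1; congr form_at.
  rewrite -scalerDr (canRL (addKr _) (e_rec k)).
  have -> : e k + e (k + 1) + (e (k + 1) + (- e k + (2 * c) *: e (k + 1))) =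
      (2 * (1 + c)) *: e (k + 1).
    by apply/rowP => i; rewrite !mxE; ring.
  rewrite !scalerA; congr (_ *: _); field.
  by rewrite c2_neq0 D_neq0.
have Hn k : ev (H k) (hvec (P (k + 1))) != 0.
  rewrite ev_form_at detZ detDl det_eQ det_eQS.
  have -> : 1 + (D * (1 + c))^-1 * (- D - D) = (c - 1) / (1 + c).
    by field; rewrite c2_neq0 D_neq0.
  rewrite mulf_neq0 ?invr_eq0 ?c2_neq0 //.
  by have /andP[_ c1] := c_itv; apply: ltr0_neq0; lra.
split.
  exact: (CPol_projective fl fr fp (fun k => fo _)).
exact: (CPol_reflective n_gt1 n_even fl fr fp fn (fun k => fo _) (fun k => fo _) HI Hn).
Qed.

(** By the half turn, [g k] vanishes at both ends of diagonal [k] and at [G]. As [g (0 + 1)] is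
    nonzero at [P 0], diagonals 0 and 1 are distinct and meet only at [G]. *)
Lemma center_diagonals (m : nat) (O : psub R) : (m + m)%:R = 0 :> 'Z_n ->
  P m%:R <> P 0 -> is_point O -> (O <= chart (P 0%R) + chart (P m%:R))%VS ->
  (O <= chart (P 1%R) + chart (P (1 + m%:R)%R))%VS -> O = <[hvec G]>%VS.
Proof.
move=> mm Pm dO O0 O1; have ht := half_turn mm Pm.
pose g k := form_at G 0 (Q k).
have gk k : ev (g k) (hvec (P k)) = 0 by rewrite ev_form_at /det2; ring.
have gm k : ev (g k) (hvec (P (k + m%:R))) = 0.
  by rewrite ev_form_at -/(Q _) ht /det2 !mxE; ring.
have gG k : ev (g k) (hvec G) = 0 := ev_form_at_center _ _ _.
have g01 : ev (g 0) (hvec (P (0 + 1))) != 0.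
  by rewrite ev_form_at -/(Q _) det_QQ add0r D_neq0.
have g10 : ev (g (0 + 1)) (hvec (P 0)) != 0.
  rewrite ev_form_at -/(Q _) add0r (_ : det2 _ _ = - D) ?oppr_eq0 ?D_neq0 //.
  by rewrite -(det_QQ 0) /det2; ring.
have sub k : (chart (P k) + chart (P (k + m%:R)%R) <= kerl (g k))%VS.
  by rewrite subv_add -!memvE !mem_kerl gk gm eqxx.
have hG : hvec G != 0.
  apply/eqP => h; have := ev_form_at_center G 1 0; rewrite h ev0 => /eqP.
  by rewrite eq_sym oner_eq0.
have hP : hvec (P 0) != 0 by apply: contraNneq g10 => ->; rewrite ev0.
apply: eq_point => //; first exact: is_point_vline.
rewrite -(@cap_line _ (kerl (g 0%R)) (kerl (g (0 + 1)%R)) <[hvec (P 0%R)]>%VS).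
- rewrite subv_cap (subv_trans _ (sub 0)) ?add0r //.
  by rewrite (subv_trans O1) // -[1 in P 1]add0r -{1}[1 in (1 + _)]add0r.
- exact: is_line_kerl g01.
- exact: is_point_vline.
- by rewrite -memvE mem_kerl gk.
- by rewrite -memvE mem_kerl.
- exact: hG.
- by rewrite mem_kerl gG.
- by rewrite mem_kerl gG.
Qed.

End Center.

Theorem proposition1p4 (R : realType) (n : nat) (P : 'Z_n -> 'rV[R]_2)
    (O : {vspace 'rV[R]_3})
    (n_ge4 : (4 <= n)%N) (n_even : ~~ odd n)
    (P_regular : regular_polygon P)
    (O_point : is_point O)
    (O_diagonals : forall i : nat, (i < n./2)%N ->
       (O <= chart (P i%:R) + chart (P (i + n./2)%N%:R))%VS) :
  let B := CPol O (fun i => chart (P i)) in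
  projective_billiard B /\ reflective n B.
Proof.
have n1 : (1 < n)%N by apply: leq_trans n_ge4.
have mE : (n./2 + n./2)%N = n by rewrite addnn halfK (negbTE n_even) subn0.
have m1 : (1 < n./2)%N by rewrite -[2%N]/((4)./2) half_leq.
have mn : (n./2 < n)%N by rewrite -{2}mE -addn1 leq_add2l ltnW.
have mm : (n./2 + n./2)%:R = 0 :> 'Z_n by rewrite mE pchar_Zp.
have [c [d [d0 c1 ed er]]] := regular_recurrence n_ge4 P_regular.
(* Otherwise the vertex of index [n./2] would lie on the line of edge 0, against strict
   convexity. *)
have Pm : P (n./2)%:R <> P 0.
  move=> e; case: P_regular => cv _ _.
  have m0 : (n./2)%:R != 0 :> 'Z_n.
    by rewrite -[0]/(0%:R) Zn_neq // ?(ltnW m1) // -?lt0n ltnW.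
  have m1' : (n./2)%:R != 0 + 1 :> 'Z_n.
    by rewrite add0r -[1]/(1%:R) Zn_neq // gtn_eqF.
  have E : orient (P 0) (P (0 + 1)) (P (n./2)%:R) = 0.
    by rewrite e orient_det2 /det2 !mxE; ring.
  by case: cv => h; have := h 0 _ m0 m1'; rewrite E ltxx.
rewrite (center_diagonals c1 d0 ed er mm Pm O_point).
- exact: (CPol_center c1 d0 ed er n1 n_even).
- by have := O_diagonals 0%N (ltnW m1).
- by have := O_diagonals 1%N m1; rewrite natrD.
Qed.
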